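(* Let $M$ be a monoid. For every subset $A\subseteq M$, the normal closure of $A$ in $M$ is $$\mathrm{ncl}_M(A)=\bigcup_{n\geq 0}A_n,$$ where $A_n$, $n\ge 0$, are the groupal submonoids of $M$ recursively defined by $A_0:=\langle A\rangle'$ and $$A_n:=\Big\langle\bigcup_{(x,y)\in X_{A_{n-1}}}xA_{n-1}y\Big\rangle',\qquad n\geq 1.$$
   Context: For a monoid $M$ with identity $1$, $U(M)$ denotes its group of units (elements with a two-sided inverse). A groupal submonoid of $M$ is a submonoid $S\subseteq M$ such that $x^{-1}\in S$ for every $x\in S\cap U(M)$. For $T\subseteq M$, $\langle T\rangle'$ denotes the smallest groupal submonoid of $M$ containing $T$ (the intersection of all groupal submonoids containing $T$). For $A\subseteq M$ and $x,y\in M$, $xAy=\{xay : a\in A\}$. The stability set of a subset $A\subseteq M$ is $X_A:=\{(x,y)\in M\times M : (xAy)\cap A\neq\emptyset\}$. A subset $A\subseteq M$ is invariant if for each $x,y\in M$ the following three conditions are equivalent: (i) $xAy\subseteq A$; (ii) $xy\in A$; (iii) $(xAy)\cap A\neq\emptyset$. A normal submonoid of $M$ is a submonoid which is both groupal and invariant. The normal closure $\mathrm{ncl}_M(A)$ of a subset $A\subseteq M$ is the smallest normal submonoid of $M$ containing $A$, i.e. the intersection of all normal submonoids of $M$ containing $A$. *)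

(* Defs.v *)
From HB Require Import structures.
From mathcomp Require Import all_boot.
From mathcomp Require Import boolp classical_sets.

Set Implicit Arguments.
Unset Strict Implicit.
Unset Printing Implicit Defensive.

Local Open Scope group_scope.
Local Open Scope classical_set_scope.

Section NormalClosure.
Variable M : monoidType.
Implicit Types (S T A : set M) (x y : M).

Definition inverse_of x y := x * y = 1 /\ y * x = 1.

Definition submonoid S := S 1 /\ (forall x y, S x -> S y -> S (x * y)).

(* [inverse_of x y] says that x is a unit of M and that y is its (unique)
   inverse, so the second clause reads: x^-1 is in S for x in S `&` U(M). *)
Definition groupal_submonoid S :=
  submonoid S /\ (forall x y, S x -> inverse_of x y -> S y).

(* <T>' ; recall that [smallest C T] is the intersection of all the sets
   containing T and satisfying C. *)
Definition groupal_closure T : set M := smallest groupal_submonoid T.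

Definition translate x A y : set M := [set x * a * y | a in A].

Definition stability_set A : set (M * M) :=
  [set p | translate p.1 A p.2 `&` A !=set0].

Definition invariant_set A := forall x y,
  [<-> translate x A y `<=` A; A (x * y); translate x A y `&` A !=set0].

Definition normal_submonoid S := groupal_submonoid S /\ invariant_set S.

Definition normal_closure A : set M := smallest normal_submonoid A.

Fixpoint closure_seq A (n : nat) : set M :=
  if n is m.+1 then
    groupal_closure (\bigcup_(p in stability_set (closure_seq A m))
                       translate p.1 (closure_seq A m) p.2)
  else groupal_closure A.

(* The intersections defining the two closures do have the required property,
   i.e., they are smallest elements. *)
Lemma groupal_closureP T : groupal_submonoid (groupal_closure T).
Proof.
split; first split.
- by move=> S [[[]]].
- move=> x y Tx Ty S CS; case: (CS) => -[[_ SM] _] _.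
  by apply: SM; [exact: (Tx S CS) | exact: (Ty S CS)].
- move=> x y Tx xy S CS; case: (CS) => -[_ SV] _.
  exact: SV (Tx S CS) xy.
Qed.

Lemma normal_closureP A : normal_submonoid (normal_closure A).
Proof.
have N1 : normal_closure A 1 by move=> S [[[[]]]].
split; first split; first split => //.
- move=> x y Ax Ay S CS; case: (CS) => -[[[_ SM] _] _] _.
  by apply: SM; [exact: (Ax S CS) | exact: (Ay S CS)].
- move=> x y Ax xy S CS; case: (CS) => -[[_ SV] _] _.
  exact: SV (Ax S CS) xy.
move=> x y; tfae.
- by move=> sub; apply: sub; exists 1; rewrite ?mulg1.
- by move=> Nxy; exists (x * y); split => //; exists 1; rewrite ?mulg1.
- move=> [_ [[a Na <-] Nxay]] _ [b Nb <-] S CS; case: (CS) => -[_ Sinv] _.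
  apply: (iffLR (Sinv x y 2 0)); last by exists b => //; exact: (Nb S CS).
  exists (x * a * y); split; last exact: (Nxay S CS).
  by exists a => //; exact: (Na S CS).
Qed.

End NormalClosure.

(* Main.v *)
(* The union of the A_n is invariant because membership of x a y in A_n with a
   in A_n puts (x, y) in the stability set of every later A_k, so that x b y lies
   in A_(k+1) for each b in A_k. Conversely, a normal submonoid containing A_n
   contains x A_n y for every (x, y) in its stability set, hence A_(n+1). *)
Require Import Defs.
From mathcomp Require Import all_boot.
From mathcomp Require Import boolp classical_sets.

Local Open Scope classical_set_scope.

Section ClosureSeq.
Local Open Scope group_scope.
Variables (M : monoidType) (A : set M).

Lemma closure_seq_groupal n : groupal_submonoid (closure_seq A n).
Proof. by case: n => [|n]; apply: groupal_closureP. Qed.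

Lemma closure_seq1 n : closure_seq A n 1.
Proof. by have [[]] := closure_seq_groupal n. Qed.

Lemma translate_closure_seqS n x y :
  stability_set (closure_seq A n) (x, y) ->
  translate x (closure_seq A n) y `<=` closure_seq A n.+1.
Proof. by move=> Xxy z xAy; apply: sub_gen_smallest; exists (x, y). Qed.

(** Since 1 is in A_n, the pair (1, 1) is in its stability set, so 1 A_n 1 = A_n is among the
    generators of A_(n+1). *)
Lemma closure_seqS n : closure_seq A n `<=` closure_seq A n.+1.
Proof.
move=> a Aa; apply: (@translate_closure_seqS n 1 1).
  by exists 1; split; [exists 1; rewrite ?mulg1 //|]; apply: closure_seq1.
by exists a; rewrite ?mul1g ?mulg1.
Qed.

Lemma closure_seq_homo m n :
  (m <= n)%N -> closure_seq A m `<=` closure_seq A n.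
Proof.
move=> /subnK <-; elim: (n - m)%N => // k IH.
exact: subset_trans IH (@closure_seqS _).
Qed.

Lemma bigcup_closure_seq_normal :
  normal_submonoid (\bigcup_n closure_seq A n).
Proof.
split; first split; first split.
- by exists 0%N => //; apply: closure_seq1.
(* The A_n form a chain, so both factors lie in the one of larger index. *)
- move=> x y [m _ Ax] [n _ Ay]; exists (maxn m n) => //.
  have [[_ AM] _] := closure_seq_groupal (maxn m n).
  by apply: AM; [move: Ax | move: Ay]; apply: closure_seq_homo;
    rewrite ?leq_maxl ?leq_maxr.
- move=> x y [n _ Ax] xy; exists n => //.
  by have [_ AV] := closure_seq_groupal n; apply: AV xy.
have U1 : (\bigcup_n closure_seq A n) 1.
  by exists 0%N => //; apply: closure_seq1.
move=> x y; tfae.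
(* In this implication and the next, x y is read as x 1 y with 1 in the union. *)
- by apply; exists 1; rewrite ?mulg1.
- by move=> Uxy; exists (x * y); split => //; exists 1; rewrite ?mulg1.
- move=> [_ [[a [m _ Aa] <-] [n _ Axay]]] _ [b [p _ Ab] <-].
  (* A level that contains a, x a y and b at once. *)
  pose k := maxn m (maxn n p).
  exists k.+1 => //; apply: (@translate_closure_seqS k x y).
    exists (x * a * y); split; first exists a => //.
      by move: Aa; apply: closure_seq_homo; rewrite leq_maxl.
    by move: Axay; apply: closure_seq_homo; rewrite /k maxnCA leq_maxl.
  by exists b => //; move: Ab; apply: closure_seq_homo; rewrite /k maxnA leq_maxr.
Qed.

Lemma closure_seq_sub_normal (S : set M) n :
  normal_submonoid S -> A `<=` S -> closure_seq A n `<=` S.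
Proof.
(* As [S] is groupal, minimality leaves only the generators of each A_n to be placed in [S]. *)
move=> [Sgr Sinv] AS; elim: n => [|n IH]; apply: smallest_sub => //.
move=> z [[x y] [_ [[a Aa <-] Axay]] xAy].
suff xSy : translate x S y `<=` S.
  by case: xAy => b Ab <-; apply: xSy; exists b => //; apply: IH.
(* Counting from 0, condition 2 of invariance is that x S y meets [S], and condition 0 is the
   inclusion. *)
apply: (iffLR (Sinv x y 2 0)).
by exists (x * a * y); split; [exists a => //; apply: IH | apply: IH].
Qed.

End ClosureSeq.

Theorem proposition2p15 (M : monoidType) (A : set M) :
  normal_closure A = \bigcup_n closure_seq A n.
Proof.
apply/seteqP; split.
  apply: smallest_sub; first exact: bigcup_closure_seq_normal.
  by move=> a Aa; exists 0%N => //; apply: sub_gen_smallest.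
move=> a [n _ Ana] S [Snormal AS].
exact: (@closure_seq_sub_normal M A S n Snormal AS).
Qed.
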